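(* Let $r\ge1$ and let $f(z_1,\dots,z_r)=\sum_{\ell_1,\dots,\ell_r\ge0}a_{\ell_1,\dots,\ell_r}z_1^{\ell_1}\cdots z_r^{\ell_r}$ be a power series converging on the open polydisk $\{|z_l|<R_l,\ l=1,\dots,r\}$. For $l=1,\dots,r$ let $X_l\in\mathbb{C}^{m\times m}$ have Jordan data (as in the context) with: - distinct eigenvalues $\lambda^{(l)}_1,\dots,\lambda^{(l)}_{K_l}$ satisfying $|\lambda^{(l)}_k|<R_l$; - geometric multiplicities $\alpha^{(G)}_{l,k}$ and block sizes $m^{(l)}_{k,i}$; - projectors $P^{(l)}_{k,i}$ and nilpotents $N^{(l)}_{k,i}$. Define $f(X_1,\dots,X_r)=\sum a_{\ell_1,\dots,\ell_r}X_1^{\ell_1}X_2^{\ell_2}\cdots X_r^{\ell_r}$. Then this series converges, and $$f(X_1,\dots,X_r)=\sum_{k_1,\dots,k_r}\ \sum_{i_1,\dots,i_r}\ \sum_{q_1=0}^{m^{(1)}_{k_1,i_1}-1}\cdots\sum_{q_r=0}^{m^{(r)}_{k_r,i_r}-1}\frac{\partial_{z_1}^{q_1}\cdots\partial_{z_r}^{q_r}f(\lambda^{(1)}_{k_1},\dots,\lambda^{(r)}_{k_r})}{q_1!\cdots q_r!}\,Q^{(1)}_{k_1,i_1,q_1}Q^{(2)}_{k_2,i_2,q_2}\cdots Q^{(r)}_{k_r,i_r,q_r}.$$ Here: - $k_l$ ranges over $1,\dots,K_l$ and $i_l$ over $1,\dots,\alpha^{(G)}_{l,k_l}$; - $Q^{(l)}_{k,i,0}=P^{(l)}_{k,i}$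 and $Q^{(l)}_{k,i,q}=(N^{(l)}_{k,i})^{q}$ for $q\ge1$; - the product of the $Q$'s is the ordered product from $l=1$ to $l=r$. Equivalently, the sum splits into three parts: - a pure projector term ($q_1=\dots=q_r=0$); - mixed terms, in which for each nonempty proper subset $\{\iota_1,\dots,\iota_\kappa\}\subsetneq\{1,\dots,r\}$ the $q_{\iota_j}\ge1$ and the other $q$'s equal $0$; - a pure nilpotent term (all $q_l\ge1$).
   Context: Jordan data. Let $X\in\mathbb{C}^{m\times m}$ have Jordan decomposition $$X=U\Big(\bigoplus_{k=1}^{K}\bigoplus_{i=1}^{\alpha_k^{(G)}}J_{m_{k,i}}(\lambda_k)\Big)U^{-1}.$$ Here: - $U$ is invertible; - $\lambda_1,\dots,\lambda_K$ are the distinct eigenvalues of $X$; - $\alpha_k^{(G)}$ is the geometric multiplicity of $\lambda_k$; - $m_{k,i}\ge 1$ are the Jordan block sizes, and $\alpha_k^{(A)}=\sum_{i}m_{k,i}$ is the algebraic multiplicity of $\lambda_k$; - $J_n(\lambda)=\lambda I_n+\acute J_n$, where $\acute J_n$ is the $n\times n$ matrix with ones on the superdiagonal and zeros elsewhere. Let $I_{k,i}$ (resp. $\acute J_{k,i}$) denote the $m\times m$ block-diagonal matrix, in the same block layout as the Jordan form, whose $(k,i)$ diagonal block is $I_{m_{k,i}}$ (resp. $\acute J_{m_{k,i}}$) and whose other blocks are zero. Define $P_{k,i}=U I_{k,i}U^{-1}$ (projectors) and $N_{k,i}=U\acute J_{k,i}U^{-1}$ (nilpotents). The matrices $X_l$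 need not commute, and the order of factors in $f(X_1,\dots,X_r)$ is as written. *)

(* Defs.v *)
(* Complex numbers are C R := (R[i])^o
   for R : realType (the regular-module alias gives R[i] its normed /
   topological structure in MathComp-Analysis). *)
From HB Require Import structures.
From mathcomp Require Import all_boot all_order all_algebra.
From mathcomp Require Import all_classical all_reals all_analysis.
From mathcomp Require Import complex.
Set Implicit Arguments. Unset Strict Implicit. Unset Printing Implicit Defensive.
Import Order.TTheory GRing.Theory Num.Theory.
Import numFieldNormedType.Exports.
Local Open Scope classical_set_scope.
Local Open Scope ring_scope.

Notation Cx R := ((R[i])^o).

(*   jalpha k : geometric multiplicity alpha_k^(G) (= number of blocks) *)
(* The block layout is  (+)_k (+)_i J_{m_{k,i}}(lambda_k), blocks       *)
(* ordered lexicographically in (k, i).                                *)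
Record jordan_data (R : realType) (m : nat) := JordanData {
  jK : nat;
  jlam : 'I_jK -> Cx R;
  jalpha : 'I_jK -> nat;
  jsize : forall k : 'I_jK, 'I_(jalpha k) -> nat;
  jU : 'M[Cx R]_m }.

Arguments jK {R m} D : rename.
Arguments jlam {R m} D k : rename.
Arguments jalpha {R m} D k : rename.
Arguments jsize {R m} D k i : rename.
Arguments jU {R m} D : rename.

Section Jordan.
Variables (R : realType) (m : nat) (D : jordan_data R m).

Definition jblock := {k : 'I_(jK D) & 'I_(jalpha D k)}.

Definition bsize (b : jblock) : nat := jsize D (tag b) (tagged b).

Definition boffset (b : jblock) : nat :=
  (\sum_(k' < jK D | (k' < tag b)%N) \sum_(i' < jalpha D k') jsize D k' i'
   + \sum_(i' < jalpha D (tag b) | (i' < tagged b)%N) jsize D (tag b) i')%N.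

Definition in_block (b : jblock) (a : nat) : bool :=
  (boffset b <= a < boffset b + bsize b)%N.

Definition Iblk (b : jblock) : 'M[Cx R]_m :=
  \matrix_(a, c) (((a == c) && in_block b a)%:R : Cx R).

Definition Jblk (b : jblock) : 'M[Cx R]_m :=
  \matrix_(a, c)
    ((((c : nat) == a.+1) && in_block b a && in_block b c)%:R : Cx R).

Definition jordan_form : 'M[Cx R]_m :=
  \sum_(b : jblock) (jlam D (tag b) *: Iblk b + Jblk b).

Definition is_jordan_decomposition (X : 'M[Cx R]_m) : Prop :=
  [/\ jU D \in unitmx,
      injective (jlam D) /\
      (forall k, 0 < jalpha D k)%N,
      (forall k (i : 'I_(jalpha D k)), 0 < jsize D k i)%N,
      (\sum_(k < jK D) \sum_(i < jalpha D k) jsize D k i)%N = m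
    & X = jU D *m jordan_form *m invmx (jU D)].

Definition Pproj (b : jblock) : 'M[Cx R]_m := jU D *m Iblk b *m invmx (jU D).
Definition Nnil (b : jblock) : 'M[Cx R]_m := jU D *m Jblk b *m invmx (jU D).

Definition Qmat (b : jblock) (q : nat) : 'M[Cx R]_m :=
  if q == 0%N then Pproj b else Nnil b ^+ q.

End Jordan.

Section PowerSeries.
Variables (R : realType) (r : nat).
Implicit Type a : {ffun 'I_r -> nat} -> Cx R.

Definition idx_of (N : nat) (t : {ffun 'I_r -> 'I_N}) : {ffun 'I_r -> nat} :=
  [ffun l => nat_of_ord (t l)].

Definition ps_term a (z : 'I_r -> Cx R) (ell : {ffun 'I_r -> nat}) : Cx R :=
  a ell * \prod_(l < r) z l ^+ ell l.

Definition ps_partial a (z : 'I_r -> Cx R) (N : nat) : Cx R :=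
  \sum_(t : {ffun 'I_r -> 'I_N}) ps_term a z (idx_of t).

Definition ps_converges_on a (Rad : 'I_r -> R) : Prop :=
  forall z : 'I_r -> Cx R, (forall l, `|z l| < (Rad l)%:C%C) ->
    exists M : R, forall N : nat,
      \sum_(t : {ffun 'I_r -> 'I_N}) `|ps_term a z (idx_of t)| <= M%:C%C.

Definition ps_fun a : 'rV[Cx R]_r -> Cx R :=
  fun z => limn (ps_partial a (fun l => z 0 l)).

Definition partial (l : 'I_r) (g : 'rV[Cx R]_r -> Cx R) : 'rV[Cx R]_r -> Cx R :=
  fun z => 'D_(delta_mx 0 l) g z.

(* d_{z_1}^{q_1} ... d_{z_r}^{q_r} g  (d_{z_r}^{q_r} applied first) *)
Definition mpartial (q : 'I_r -> nat) (g : 'rV[Cx R]_r -> Cx R) :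
    'rV[Cx R]_r -> Cx R :=
  foldr (fun l h => iter (q l) (partial l) h) g (enum 'I_r).

Definition mat_partial (m : nat) a (X : 'I_r -> 'M[Cx R]_m) (N : nat) :
    'M[Cx R]_m :=
  \sum_(t : {ffun 'I_r -> 'I_N})
     a (idx_of t) *: \prod_(l < r) X l ^+ idx_of t l.

End PowerSeries.

(* Main.v *)
(* By orthogonality of the Jordan blocks and the binomial formula on each block,
   X^n = sum_(b, q) C(n, q) lambda_b^(n - q) Q_(b, q).  Multiplying out, the
   partial sums of f(X_1, ..., X_r) over boxes are finite combinations of the
   products of Q's, whose coefficients are the box sums of
   a_t prod_l C(t_l, q_l) lambda_l^(t_l - q_l).  Up to the factorials these are
   the partial sums of the termwise derivative of f at an eigenvalue tuple, so
   it remains to differentiate f termwise on the polydisk.  This rests on two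
   consequences of the binomial expansion of (|z| + d)^n, both dominating by
   the absolutely convergent series at a larger radius:
   n^_q |z|^(n - q) <= q! / d^q (|z| + d)^n, and the Taylor estimate
   |(z + h)^n - z^n - n h z^(n - 1)| <= (|h| / d)^2 (|z| + d)^n. *)
Require Import Defs.
From HB Require Import structures.
From mathcomp Require Import all_boot all_order all_algebra.
From mathcomp Require Import all_classical all_reals all_analysis.
From mathcomp Require Import complex ring.
Set Implicit Arguments. Unset Strict Implicit. Unset Printing Implicit Defensive.
Import Order.TTheory GRing.Theory Num.Theory.
Import numFieldNormedType.Exports.
Local Open Scope classical_set_scope.
Local Open Scope ring_scope.

(** * Powers of a matrix in Jordan form *)

Lemma prefix_sumS (n : nat) (s : 'I_n -> nat) (i : 'I_n) :
  (\sum_(j < n | (j < i.+1)%N) s j = \sum_(j < n | (j < i)%N) s j + s i)%N.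
Proof.
rewrite (bigD1 i) ?leqnn//= addnC; congr addn; apply: eq_bigl => j.
by rewrite ltnS ltn_neqAle andbC.
Qed.

Lemma prefix_sum_leq (n : nat) (s : 'I_n -> nat) (p q : nat) : (p <= q)%N ->
  (\sum_(j < n | (j < p)%N) s j <= \sum_(j < n | (j < q)%N) s j)%N.
Proof.
move=> pq; rewrite big_mkcond [leqRHS]big_mkcond/=; apply: leq_sum => j _.
by case: ifP => // jp; rewrite (leq_trans jp pq).
Qed.

(** The least [p] whose prefix sum exceeds [a] is positive, and its predecessor is the required
    index. *)
Lemma prefix_sum_interval (n : nat) (s : 'I_n -> nat) (a : nat) :
  (a < \sum_(i < n) s i)%N ->
  exists i : 'I_n, (\sum_(j < n | (j < i)%N) s j <= a
     < \sum_(j < n | (j < i)%N) s j + s i)%N.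
Proof.
move=> a_lt; pose P p := (a < \sum_(j < n | (j < p)%N) s j)%N.
have Pn : P n by rewrite /P; under eq_bigl do rewrite ltn_ord.
have [|p Pp pmin] := @ex_minnP P; first by exists n.
case: p => [|p] in Pp pmin *; first by rewrite /P big_pred0 in Pp.
have pn : (p < n)%N by exact: pmin.
exists (Ordinal pn); rewrite -prefix_sumS /= [X in _ && X]Pp andbT leqNgt.
by apply/negP => /pmin; rewrite ltnn.
Qed.

Lemma prefix_sum_interval_inj (n : nat) (s : 'I_n -> nat) (a : nat)
    (i j : 'I_n) :
  (\sum_(k < n | (k < i)%N) s k <= a < \sum_(k < n | (k < i)%N) s k + s i)%N ->
  (\sum_(k < n | (k < j)%N) s k <= a < \sum_(k < n | (k < j)%N) s k + s j)%N ->
  i = j.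
Proof.
have wlog_lt (i' j' : 'I_n) : (i' < j')%N ->
    (a < \sum_(k < n | (k < i')%N) s k + s i')%N ->
    (\sum_(k < n | (k < j')%N) s k <= a)%N -> False.
  rewrite -prefix_sumS => ij ai /(leq_ltn_trans)/(_ ai).
  by rewrite ltnNge prefix_sum_leq.
move=> /andP[li ui] /andP[lj uj]; apply/val_inj => /=.
by case: (ltngtP i j) => // ij; [case: (wlog_lt i j)|case: (wlog_lt j i)].
Qed.

(** Distributivity with the order of factors kept, for index types that vary with the factor: the
    blocks of [X l], and then the range of the exponent [q l], depend on [l]. *)
Lemma prod_sum_dffun (S : pzSemiRingType) (I : finType) (T : I -> finType)
    (F : forall i, T i -> S) :
  \prod_i \sum_(j : T i) F i j
    = \sum_(f : {dffun forall i, T i}) \prod_i F i (f i).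
Proof.
rewrite (reindex (@dffun_of_fprod I T)); last first.
  exact/onW_bij/dffun_of_fprod_bij.
pose P i : {ffun T i -> S} := [ffun j => F i j].
transitivity (\sum_(t : fprod T) \prod_(i in I) P i (t i)); last first.
  by apply: eq_bigr => t _; apply: eq_bigr => i _; rewrite !ffunE.
rewrite big_fprod.
(* All the [T i] embed in one tagged type, where non-dependent distributivity applies; the default
   [0] of [untag] is never reached, since the sums are restricted to matching tags. *)
rewrite -(bigA_distr_big_dep (tagged_with T) (fun i => untag 0 (P i))).
apply: eq_bigr => i _; rewrite big_tag.
by apply: eq_bigr => u; rewrite inE => /eqP ui; rewrite !untagE ffunE.
Qed.

Lemma prod_mx_scale (S : comPzRingType) (m : nat) (I : Type) (s : seq I)
    (c : I -> S) (A : I -> 'M[S]_m) :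
  \prod_(i <- s) (c i *: A i) = (\prod_(i <- s) c i) *: \prod_(i <- s) A i.
Proof.
elim: s => [|i s IH]; first by rewrite !big_nil scale1r.
by rewrite !big_cons IH -!mulmxE -scalemxAl -scalemxAr scalerA.
Qed.

Lemma conjmxX (F : fieldType) (m : nat) (U A : 'M[F]_m) (n : nat) :
  U \in unitmx -> (U *m A *m invmx U) ^+ n = U *m A ^+ n *m invmx U.
Proof.
move=> Uu; elim: n => [|n IH]; first by rewrite !expr0 mulmx1 mulmxV.
by rewrite !exprS IH -!mulmxE !mulmxA mulmxKV.
Qed.

(** * Block projectors and nilpotents of the Jordan form *)

Section JordanCalculus.
Context (R : realType) (m : nat) (D : jordan_data R m).

(** Separates the start of the eigenvalue group from the position inside it, so that the prefix-sum
    lemmas apply at each level; [off <= a] guards the truncated subtraction. *)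
Lemma in_blockE (b : jblock D) (a : nat) :
  let off := (\sum_(k' < jK D | (k' < tag b)%N)
                \sum_(i' < jalpha D k') jsize D k' i')%N in
  let off' := (\sum_(i' < jalpha D (tag b) | (i' < tagged b)%N)
                 jsize D (tag b) i')%N in
  in_block b a = [&& (off <= a)%N & (off' <= a - off < off' + bsize b)%N].
Proof.
rewrite /= /in_block /boffset; set o := \sum_(_ < _ | _) _.
set o' := \sum_(_ < _ | _) _; case: (leqP o a) => [oa|ao] /=.
  by rewrite leq_subRL// ltn_subLR// addnA.
by rewrite leqNgt (leq_trans ao) // leq_addr.
Qed.

Lemma in_block_exists (a : nat) :
  (a < \sum_(k < jK D) \sum_(i < jalpha D k) jsize D k i)%N ->
  exists b : jblock D, in_block b a.
Proof.
move=> /prefix_sum_interval[k /andP[lk uk]].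
have [|i ik] := @prefix_sum_interval (jalpha D k) (jsize D k)
  (a - \sum_(j < jK D | (j < k)%N) \sum_(i < jalpha D j) jsize D j i)%N.
  by rewrite ltn_subLR.
by exists (existT _ k i); rewrite in_blockE /= lk.
Qed.

Lemma in_block_inj (b b' : jblock D) (a : nat) :
  in_block b a -> in_block b' a -> b = b'.
Proof.
rewrite !in_blockE; case: b b' => [k i] [k' i'] /= /and3P[lk li ui].
move=> /and3P[lk' li' ui'].
have le_size l (j : 'I_(jalpha D l)) :
  (\sum_(j' < jalpha D l | (j' < j)%N) jsize D l j' + jsize D l j
     <= \sum_(j' < jalpha D l) jsize D l j')%N.
  rewrite -prefix_sumS; apply: (leq_trans (prefix_sum_leq _ (ltn_ord j))).
  by rewrite (eq_bigl xpredT)// => j'; rewrite ltn_ord.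
(* Each block ends inside its group, so [a] lies in the group intervals of both [k] and [k']. *)
have kk' : k = k'.
  apply: (@prefix_sum_interval_inj _
    (fun k => \sum_(i < jalpha D k) jsize D k i)%N a).
    by rewrite lk/= -ltn_subLR//; exact: leq_trans ui (le_size _ _).
  by rewrite lk'/= -ltn_subLR//; exact: leq_trans ui' (le_size _ _).
case: _ / kk' in i' lk' li' ui' *; congr existT.
by apply: (@prefix_sum_interval_inj _ (jsize D k)); apply/andP; split;
  eassumption.
Qed.

(** Since the block sizes add up to [m], every row index lies in exactly one block. *)
Lemma sum_Iblk :
  (\sum_(k < jK D) \sum_(i < jalpha D k) jsize D k i)%N = m ->
  \sum_(b : jblock D) Iblk b = 1%:M.
Proof.
move=> sz; apply/matrixP => i j; rewrite summxE !mxE.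
have [|b ib] := @in_block_exists i; last first.
  rewrite (bigD1 b)//= mxE ib andbT big1 ?addr0// => b' b'b.
  rewrite mxE; case: (boolP (in_block b' i)) => [ib'|_]; last by rewrite andbF.
  by rewrite (in_block_inj ib' ib) eqxx in b'b.
by rewrite sz.
Qed.

Lemma Iblk_mulmxE (b : jblock D) (A : 'M[Cx R]_m) i j :
  (Iblk b *m A) i j = (in_block b i)%:R * A i j.
Proof.
rewrite mxE (bigD1 i)//= mxE eqxx /= big1 ?addr0// => k ki.
by rewrite mxE eq_sym (negbTE ki) mul0r.
Qed.

Lemma mulmx_IblkE (b : jblock D) (A : 'M[Cx R]_m) i j :
  (A *m Iblk b) i j = A i j * (in_block b j)%:R.
Proof.
rewrite mxE (bigD1 j)//= mxE eqxx /= big1 ?addr0// => k kj.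
by rewrite mxE (negbTE kj) mulr0.
Qed.

Lemma Iblk_Iblk (b : jblock D) : Iblk b *m Iblk b = Iblk b.
Proof.
apply/matrixP => i j; rewrite mulmx_IblkE !mxE.
by rewrite -natrM mulnb; case: eqVneq => [->|]; rewrite /= ?andbb.
Qed.

Lemma Iblk_Iblk0 (b b' : jblock D) : b' != b -> Iblk b' *m Iblk b = 0.
Proof.
move=> b'b; apply/matrixP => i j; rewrite mulmx_IblkE !mxE.
have [->|] := eqVneq i j; rewrite ?mul0r //= -natrM mulnb.
case: (boolP (_ && _)) => // /andP[ib' ib].
by rewrite (in_block_inj ib' ib) eqxx in b'b.
Qed.

Lemma Jblk_Iblk (b : jblock D) : Jblk b *m Iblk b = Jblk b.
Proof.
by apply/matrixP => i j; rewrite mulmx_IblkE !mxE -natrM mulnb -andbA andbb.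
Qed.

Lemma Iblk_Jblk (b : jblock D) : Iblk b *m Jblk b = Jblk b.
Proof.
apply/matrixP => i j; rewrite Iblk_mulmxE !mxE -natrM mulnb.
by case: (in_block b i); rewrite ?andbF.
Qed.

Lemma Jblk_Iblk0 (b b' : jblock D) : b' != b -> Jblk b' *m Iblk b = 0.
Proof. by move=> ?; rewrite -Jblk_Iblk -mulmxA Iblk_Iblk0 ?mulmx0. Qed.

Lemma Jblk_neq0 (b : jblock D) i j :
  Jblk b i j != 0 -> [/\ (j = i.+1 :> nat)%N, in_block b i & in_block b j].
Proof.
by rewrite mxE pnatr_eq0 eqb0 negbK -andbA => /and3P[/eqP].
Qed.

(** Only the support is tracked, as nilpotency needs no entry values. The powers start at 1 because
    the zeroth power is the full identity, which is not confined to the block. *)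
Lemma Jblk_exp_neq0 (b : jblock D) (n : nat) i j :
  (Jblk b ^+ n.+1) i j != 0 ->
  [/\ (j = i + n.+1 :> nat)%N, in_block b i & in_block b j].
Proof.
elim: n i j => [|n IH] i j; first by rewrite expr1 addn1 => /Jblk_neq0.
rewrite exprS -mulmxE mxE => neq0.
have [k] : exists k, Jblk b i k * (Jblk b ^+ n.+1) k j != 0.
  apply/existsP; apply: contra_neqT neq0; rewrite negb_exists => /forallP all0.
  by apply: big1 => k _; have /negPn/eqP := all0 k.
rewrite mulf_eq0 negb_or => /andP[/Jblk_neq0[ik bi _] /IH[-> _ bj]].
by split; rewrite // ik addSnnS.
Qed.

(** Two indices of one block differ by less than its size. *)
Lemma Jblk_nilpotent (b : jblock D) (n : nat) :
  (0 < bsize b)%N -> (bsize b <= n)%N -> Jblk b ^+ n = 0.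
Proof.
case: n => [|n]; first by case: bsize.
move=> _ le_n; apply/matrixP => i j; rewrite [RHS]mxE; apply/eqP.
apply: contraTT le_n => /Jblk_exp_neq0[-> /andP[oi _] /andP[_ ni]].
by rewrite -ltnNge -(ltn_add2l (boffset b)) (leq_ltn_trans _ ni)// leq_add2r.
Qed.

Lemma jordan_form_Iblk (b : jblock D) :
  jordan_form D *m Iblk b = (jlam D (tag b))%:M *m Iblk b + Jblk b *m Iblk b.
Proof.
rewrite /jordan_form mulmx_suml (bigD1 b)//= mulmxDl -scalemxAl Iblk_Iblk.
rewrite mul_scalar_mx big1 ?addr0// => b' b'b.
by rewrite mulmxDl -scalemxAl Iblk_Iblk0// scaler0 Jblk_Iblk0// addr0.
Qed.

(** [A] contains a full scalar matrix, not a multiple of [Iblk b]: it agrees with the Jordan form on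
    the block and commutes with [Iblk b], so the powers agree there too. *)
Lemma jordan_form_exp_Iblk (b : jblock D) (n : nat) :
  jordan_form D ^+ n *m Iblk b
    = ((jlam D (tag b))%:M + Jblk b) ^+ n *m Iblk b.
Proof.
set A := _ + Jblk b.
have AI k : A ^+ k *m Iblk b = Iblk b *m A ^+ k.
  rewrite mulmxE; apply/esym/commrX; rewrite /GRing.comm -mulmxE /A mulmxDl.
  by rewrite mulmxDr Jblk_Iblk Iblk_Jblk scalar_mxC.
have JI : jordan_form D *m Iblk b = A *m Iblk b.
  by rewrite jordan_form_Iblk -mulmxDl.
elim: n => [|n IH]; first by rewrite !expr0.
rewrite [in LHS]exprS -mulmxE -mulmxA IH AI mulmxA JI -mulmxA -AI mulmxA.
by rewrite mulmxE -exprS.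
Qed.

(** [Qmat] before conjugation by [jU D]. *)
Definition Jpow (b : jblock D) (q : nat) : 'M[Cx R]_m :=
  if q == 0%N then Iblk b else Jblk b ^+ q.

Lemma JpowE (b : jblock D) (q : nat) : Jblk b ^+ q *m Iblk b = Jpow b q.
Proof.
rewrite /Jpow; case: q => [|q] /=; first by rewrite expr0 mul1mx.
by rewrite exprSr -mulmxE -mulmxA Jblk_Iblk.
Qed.

Lemma QmatE (b : jblock D) (q : nat) : jU D \in unitmx ->
  Qmat b q = jU D *m Jpow b q *m invmx (jU D).
Proof. by move=> Uu; rewrite /Qmat /Jpow; case: eqP => // _; exact: conjmxX. Qed.

(** In the binomial formula, terms beyond [n] vanish with the binomial coefficient and terms from
    the block size on by nilpotency, so either cutoff gives the same sum. *)
Lemma jordan_block_expn (b : jblock D) (n : nat) : (0 < bsize b)%N ->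
  ((jlam D (tag b))%:M + Jblk b) ^+ n *m Iblk b
    = \sum_(q < bsize b) ('C(n, q)%:R * jlam D (tag b) ^+ (n - q)) *: Jpow b q.
Proof.
move=> b_gt0; set l := jlam D (tag b).
have expl k : l%:M ^+ k = (l ^+ k)%:M :> 'M[Cx R]_m.
  elim: k => [|k IH]; first by rewrite !expr0.
  by rewrite !exprS IH -mulmxE -scalar_mxM.
pose G q := ('C(n, q)%:R * l ^+ (n - q)) *: Jpow b q.
have G_big q : (bsize b <= q)%N -> G q = 0.
  by move=> bq; rewrite /G -JpowE Jblk_nilpotent// mul0mx scaler0.
have G_bin q : (n < q)%N -> G q = 0.
  by move=> nq; rewrite /G bin_small// mul0r scale0r.
rewrite exprDn_comm; last by rewrite /GRing.comm -!mulmxE scalar_mxC.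
rewrite mulmx_suml.
transitivity (\sum_(q < n.+1) G q).
  apply: eq_bigr => q _; rewrite /G expl -mulmxE mul_scalar_mx.
  by rewrite -scaler_nat scalerA -scalemxAl JpowE.
rewrite -(big_mkord xpredT G) -[RHS](big_mkord xpredT G).
have widen k : (k <= n.+1 + bsize b)%N -> (forall q, (k <= q)%N -> G q = 0) ->
    \sum_(0 <= q < k) G q = \sum_(0 <= q < n.+1 + bsize b) G q.
  move=> kn G0; rewrite [RHS](@big_cat_nat _ _ _ k)//= [X in _ + X]big_nat.
  by rewrite [X in _ + X]big1 ?addr0// => q /andP[/G0].
by rewrite !widen ?leq_addl ?leq_addr.
Qed.

Lemma jordan_expn (X : 'M[Cx R]_m) (n : nat) : is_jordan_decomposition D X ->
  X ^+ n = \sum_(b : jblock D) \sum_(q < bsize b)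
    ('C(n, q)%:R * jlam D (tag b) ^+ (n - q)) *: Qmat b q.
Proof.
move=> [Uu _ sz_gt0 sz ->]; rewrite conjmxX//.
(* The resolution of the identity by the [Iblk b] splits the power into blocks. *)
rewrite -[jordan_form D ^+ n]mulmx1 -sum_Iblk// !mulmx_sumr mulmx_suml.
apply: eq_bigr => b _; rewrite jordan_form_exp_Iblk.
rewrite jordan_block_expn; last exact: sz_gt0.
rewrite mulmx_sumr mulmx_suml; apply: eq_bigr => q _.
by rewrite QmatE// -scalemxAr -scalemxAl.
Qed.

End JordanCalculus.

(** * Absolutely convergent multiple series *)

Section ComplexLimits.
Context (R : realType).
Implicit Types x y : Cx R.

Lemma Re_sum (I : Type) (s : seq I) (P : pred I) (F : I -> Cx R) :
  complex.Re (\sum_(i <- s | P i) F i) = \sum_(i <- s | P i) complex.Re (F i).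
Proof. by apply: big_morph => [[? ?] [? ?]|]. Qed.

Lemma Im_sum (I : Type) (s : seq I) (P : pred I) (F : I -> Cx R) :
  complex.Im (\sum_(i <- s | P i) F i) = \sum_(i <- s | P i) complex.Im (F i).
Proof. by apply: big_morph => [[? ?] [? ?]|]. Qed.

Lemma norm_i : `|'i%C : Cx R| = 1.
Proof. by rewrite normc_def /= expr0n expr1n add0r sqrtr1. Qed.

Lemma Re_norm_le x : `|complex.Re x| <= complex.Re `|x|.
Proof. by rewrite -lecR RRe_real ?normr_real// normc_ge_Re. Qed.

Lemma Im_norm_le x : `|complex.Im x| <= complex.Re `|x|.
Proof.
(* Multiplication by -i preserves the norm and moves the imaginary part to the real part. *)
have -> : complex.Im x = complex.Re (- ('i%C * x : Cx R)).
  by case: x => a b /=; rewrite mul0r mul1r sub0r opprK.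
have -> : `|x| = `|- ('i%C * x : Cx R)|.
  by rewrite normrN normrM norm_i mul1r.
exact: Re_norm_le.
Qed.

Lemma norm_le_ReIm x : `|x| <= (`|complex.Re x| + `|complex.Im x|)%:C%C.
Proof.
rewrite {1}[x]complexE (le_trans (ler_normD _ _))// normrM.
have nR (a : R) : `|a%:C%C : Cx R| = (`|a|)%:C%C.
  by rewrite normc_def /= expr0n addr0 sqrtr_sqr.
by rewrite norm_i mul1r !nR rmorphD.
Qed.

Lemma cvg_ReIm (f : nat -> Cx R) (a b : R) :
  complex.Re (f n) @[n --> \oo] --> a -> complex.Im (f n) @[n --> \oo] --> b ->
  f @ \oo --> ((a +i* b)%C : Cx R).
Proof.
move=> /cvgrPdist_lt fa /cvgrPdist_lt fb; apply/cvgrPdist_lt => e e0.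
have [d de] : exists d : R, e = d%:C%C.
  by apply/complex_realP; rewrite ger0_real// ltW.
have d0 : 0 < d / 2 by rewrite divr_gt0// -ltcR -de.
have {fa}fa := fa _ d0; have {fb}fb := fb _ d0; near=> n.
apply: (le_lt_trans (norm_le_ReIm _)); rewrite de ltcR [ltRHS]splitr.
have ReB : complex.Re (((a +i* b)%C : Cx R) - f n) = a - complex.Re (f n).
  by case: (f n).
have ImB : complex.Im (((a +i* b)%C : Cx R) - f n) = b - complex.Im (f n).
  by case: (f n).
by rewrite ReB ImB ltrD//; [near: n; exact: fa|near: n; exact: fb].
Unshelve. all: by end_near. Qed.

(** The order on complex numbers is partial, so arguing by contradiction requires [c] to be real;
    this holds because [c] bounds a norm. *)
Lemma cvgn_norm_le (f : nat -> Cx R) (L c : Cx R) :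
  f @ \oo --> L -> (forall n, `|f n| <= c) -> `|L| <= c.
Proof.
move=> fL fc; have c_real : c \is Num.real.
  by rewrite ger0_real// (le_trans _ (fc 0%N)).
rewrite real_leNgt ?normr_real//; apply/negP => cL.
have [n _ /(_ n (leqnn _))] := @cvgr_norm_gt _ _ _ _ _ _ _ fL _ cL.
by move=> /= /lt_le_trans/(_ (fc n)); rewrite ltxx.
Qed.

End ComplexLimits.

(** * Partial sums over boxes of multi-indices *)

Section BoxSums.
Context (r : nat).

Definition box_sum (V : nmodType) (u : {ffun 'I_r -> nat} -> V) (N : nat) : V :=
  \sum_(t : {ffun 'I_r -> 'I_N}) u (idx_of t).

(** Puts both boxes in one index type, where their sums can be compared. *)
Lemma box_sum_sub (V : nmodType) (u : {ffun 'I_r -> nat} -> V) (N M : nat) :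
  (N <= M)%N -> box_sum u N =
    \sum_(t : {ffun 'I_r -> 'I_M} | [forall l, (t l < N)%N]) u (idx_of t).
Proof.
move=> NM; pose w (t : {ffun 'I_r -> 'I_N}) := [ffun l => widen_ord NM (t l)].
have w_inj : injective w.
  move=> s t /ffunP st; apply/ffunP => l; apply/val_inj.
  by have := st l; rewrite !ffunE => /(congr1 val).
have idx_w t : idx_of (w t) = idx_of t.
  by apply/ffunP => l; rewrite !ffunE.
have im_w (t : {ffun 'I_r -> 'I_M}) :
    [forall l, (t l < N)%N]
      = (t \in [set w s | s in [set: {ffun 'I_r -> 'I_N}]]%SET).
  apply/forallP/imsetP => [tN|[s _ ->] l]; last by rewrite ffunE /= ltn_ord.
  exists [ffun l => Ordinal (tN l)]; first by rewrite inE.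
  by apply/ffunP => l; apply/val_inj; rewrite !ffunE.
rewrite (eq_bigl _ _ im_w) big_imset/=; last by move=> ? ? _ _; exact: w_inj.
by apply: eq_big => [t|t _]; rewrite ?inE ?idx_w.
Qed.

Lemma box_sum_nondecreasing (R : numDomainType)
    (v : {ffun 'I_r -> nat} -> R) : (forall t, 0 <= v t) ->
  {homo box_sum v : n m / (n <= m)%N >-> n <= m}.
Proof.
move=> v0 n m nm; rewrite (box_sum_sub v nm) big_mkcond; apply: ler_sum => t _.
by case: ifP.
Qed.

(* [w = (w + v) - v] is a difference of two nonnegative families, whose box
   sums are monotone and bounded. *)
Lemma box_sum_cvgn_real (R : realType) (w v : {ffun 'I_r -> nat} -> R) (M : R) :
  (forall t, `|w t| <= v t) -> (forall N, box_sum v N <= M) ->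
  cvgn (box_sum w).
Proof.
move=> wv vM; have v0 t : 0 <= v t by rewrite (le_trans _ (wv t)).
have bcv u K : (forall t, 0 <= u t) -> (forall N, box_sum u N <= K) ->
    cvgn (box_sum u : R^nat).
  move=> u0 uK; apply: nondecreasing_is_cvgn.
    exact: box_sum_nondecreasing.
  by exists K => _ [N _ <-].
have vc := bcv v M v0 vM.
have wvc : cvgn (box_sum (fun t => w t + v t) : R^nat).
  apply: (bcv _ (M + M)) => [t|N].
    by rewrite -lerBlDr sub0r; have := wv t; rewrite ler_norml => /andP[].
  rewrite /box_sum big_split/= lerD ?vM// (le_trans _ (vM N))//.
  by apply: ler_sum => t _; rewrite (le_trans (ler_norm _)).
have -> : (box_sum w : R^nat) = box_sum (fun t => w t + v t) \- box_sum v.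
  by apply/funext => N; rewrite /box_sum /= big_split/= addrK.
exact: is_cvgB.
Qed.

(** Real and imaginary parts are both dominated by the norm, so the real criterion applies to
    each. *)
Lemma box_sum_cvgn (R : realType) (u : {ffun 'I_r -> nat} -> Cx R) (M : Cx R) :
  (forall N, box_sum (fun t => `|u t|) N <= M) -> cvgn (box_sum u).
Proof.
move=> uM.
have vM N : box_sum (fun t => complex.Re `|u t|) N <= complex.Re M.
  by have := uM N; rewrite lecE => /andP[_]; rewrite /box_sum Re_sum.
have /cvg_ex[/= a ra] := box_sum_cvgn_real (fun t => Re_norm_le (u t)) vM.
have /cvg_ex[/= b ib] := box_sum_cvgn_real (fun t => Im_norm_le (u t)) vM.
apply/cvg_ex; exists ((a +i* b)%C : Cx R); apply: cvg_ReIm.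
  by under eq_fun do rewrite /box_sum Re_sum; exact: ra.
by under eq_fun do rewrite /box_sum Im_sum; exact: ib.
Qed.

End BoxSums.

(** * Termwise differentiation *)

(** Up to the factor q! / d^q, the left side is a single term of the binomial expansion of (x +
    d)^n. *)
Lemma ffact_exp_le (K : numFieldType) (x d : K) (n q : nat) :
  0 <= x -> 0 < d ->
  (n ^_ q)%:R * x ^+ (n - q) <= (q`!)%:R / d ^+ q * (x + d) ^+ n.
Proof.
move=> x0 d0; have [nq|qn] := ltnP n q.
  rewrite ffact_small// mul0r mulr_ge0 ?divr_ge0 ?exprn_ge0 ?ler0n//.
    exact: ltW.
  by rewrite addr_ge0// ltW.
rewrite mulrAC ler_pdivlMr ?exprn_gt0// -bin_ffact natrM -!mulrA mulrCA.
rewrite ler_wpM2l ?ler0n// exprDn.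
have qn1 : (q < n.+1)%N by [].
rewrite (bigD1 (Ordinal qn1))//= mulr_natl lerDl sumr_ge0// => i _.
by rewrite mulrn_wge0// mulr_ge0// exprn_ge0// ltW.
Qed.

(** The remainder is the part of the binomial expansion of degree at least 2 in [h], compared term
    by term with that of (|z| + d)^n through |h|^(i + 2) <= (|h| / d)^2 d^(i + 2). *)
Lemma exprD_taylor_le (K : numFieldType) (z h d : K) (n : nat) :
  0 < d -> `|h| <= d ->
  `|(z + h) ^+ n - z ^+ n - h * (n%:R * z ^+ n.-1)|
    <= (`|h| / d) ^+ 2 * (`|z| + d) ^+ n.
Proof.
move=> d0 hd; have d_ge0 := ltW d0.
have rhs_ge0 k : 0 <= (`|h| / d) ^+ 2 * (`|z| + d) ^+ k.
  by rewrite mulr_ge0 ?exprn_ge0 ?divr_ge0 ?addr_ge0.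
case: n => [|[|n]].
- by rewrite (_ : _ - _ - _ = 0) ?normr0//; ring.
- by rewrite (_ : _ - _ - _ = 0) ?normr0//=; ring.
rewrite exprDn 2!big_ord_recl /= !bin0 bin1 !subn0 expr0 mulr1 !mulr1n.
rewrite subSS subn0 expr1; set S := \sum_(i < _) _.
have -> : z ^+ n.+2 + (z ^+ n.+1 * h *+ n.+2 + S) - z ^+ n.+2
    - h * (n.+2%:R * z ^+ n.+1) = S by ring.
rewrite exprDn 2!big_ord_recl /= addrA mulrDr.
rewrite -[leLHS]add0r lerD//.
  apply: mulr_ge0; first by rewrite exprn_ge0// divr_ge0.
  by apply: addr_ge0; rewrite mulrn_wge0// mulr_ge0// exprn_ge0.
rewrite mulr_sumr (le_trans (ler_norm_sum _ _ _))// ler_sum// => i _.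
rewrite normrMn mulrnAr lerMn2r normrM !normrX; apply/orP; right.
rewrite (mulrCA (_ ^+ 2)) ler_wpM2l ?exprn_ge0// /bump /= !add1n -addn2 !exprD.
rewrite expr_div_n mulrCA mulfVK ?expf_neq0 ?gt_eqF//.
by rewrite ler_wpM2r ?exprn_ge0// lerXn2r ?nnegrE.
Qed.

Section DerivedSeries.
Context (R : realType) (r : nat).
Implicit Types (a : {ffun 'I_r -> nat} -> Cx R) (q : 'I_r -> nat).
Implicit Types (z : 'I_r -> Cx R) (Rad : 'I_r -> R).

Definition in_polydisk Rad z := forall l, `|z l| < (Rad l)%:C%C.

(* The term of index [t] of the series obtained by differentiating [a]
   termwise [q l] times in the variable [l].  The truncated subtraction is
   harmless because the falling factorial vanishes for [t l < q l]. *)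
Definition dterm a q z (t : {ffun 'I_r -> nat}) : Cx R :=
  a t * \prod_(l < r) ((t l ^_ q l)%:R * z l ^+ (t l - q l)).

(** [limn] is a true limit only where the box sums converge; [dseries_cvg] ensures this on the
    polydisk. *)
Definition dseries a q z : Cx R := limn (box_sum (dterm a q z)).

Lemma ps_fun_dseries a (z : 'rV[Cx R]_r) :
  ps_fun a z = dseries a (fun=> 0%N) (z 0).
Proof.
congr (limn _); apply/funext => N; apply: eq_bigr => t _.
congr (_ * _); apply: eq_bigr => l _.
by rewrite ffactn0 subn0 mul1r.
Qed.

Lemma dterm_bounded a Rad q z : ps_converges_on a Rad -> in_polydisk Rad z ->
  exists M : Cx R, forall N, box_sum (fun t => `|dterm a q z t|) N <= M.
Proof.
(* The midpoint radius [s] stays in the polydisk, and its gap to the norm of [z l] serves as the [d]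
   of [ffact_exp_le]. *)
move=> acv zR; pose s l : Cx R := (`|z l| + (Rad l)%:C%C) / 2.
have zs l : `|z l| < s l by rewrite midf_lt.
have s_ge0 l : 0 <= s l by rewrite ltW// (le_lt_trans _ (zs l)).
have sR : in_polydisk Rad s.
  by move=> l; rewrite ger0_norm// midf_lt.
have [M sM] := acv s sR.
pose c l : Cx R := (q l)`!%:R / (s l - `|z l|) ^+ q l.
exists (\prod_(l < r) c l * M%:C%C) => N.
have c_ge0 : 0 <= \prod_(l < r) c l.
  by apply: prodr_ge0 => l _; rewrite divr_ge0 ?exprn_ge0 ?subr_ge0// ltW.
apply: le_trans (ler_wpM2l c_ge0 (sM N)); rewrite mulr_sumr.
apply: ler_sum => t _; rewrite /dterm /ps_term !normrM mulrCA ler_wpM2l//.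
rewrite !normr_prod -big_split/=; apply: ler_prod => l _; rewrite normr_ge0/=.
rewrite normrM !normrX normr_nat (ger0_norm (s_ge0 l)).
apply: (le_trans (ffact_exp_le _ _ (normr_ge0 _) (_ : 0 < s l - `|z l|))).
  by rewrite subr_gt0.
by rewrite (addrC `|z l|) subrK.
Qed.

Lemma dseries_cvg a Rad q z : ps_converges_on a Rad -> in_polydisk Rad z ->
  box_sum (dterm a q z) @ \oo --> dseries a q z.
Proof. by move=> acv /(dterm_bounded q acv)[M /box_sum_cvgn]. Qed.

(** Only the factor of index [l] moves; the others pull out as [p], leaving the one-variable
    estimate with exponent [t l - q l]. *)
Lemma dterm_taylor_le a q z (l : 'I_r) (h d : Cx R) t : 0 < d -> `|h| <= d ->
  `|dterm a q (fun j => h *+ (j == l) + z j) t - dterm a q z t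
      - h * dterm a (fun j => q j + (j == l))%N z t|
    <= (`|h| / d) ^+ 2
       * `|dterm a q (fun j => if j == l then `|z j| + d else z j) t|.
Proof.
move=> d0 hd; rewrite /dterm !(bigD1 (P := xpredT) l)//= !eqxx.
have rest (F G : 'I_r -> Cx R) : (forall j, j != l -> F j = G j) ->
    \prod_(j < r | j != l) F j = \prod_(j < r | j != l) G j.
  by move=> FG; apply: eq_bigr.
set p := \prod_(j < r | j != l) ((t j ^_ q j)%:R * z j ^+ (t j - q j)).
rewrite (rest _ (fun j => (t j ^_ q j)%:R * z j ^+ (t j - q j))); last first.
  by move=> j /negbTE ->; rewrite mulr0n add0r.
rewrite [X in _ - _ * (_ * (_ * X))](rest _
  (fun j => (t j ^_ q j)%:R * z j ^+ (t j - q j))); last first.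
  by move=> j /negbTE ->; rewrite addn0.
rewrite [X in _ <= _ * `|_ * (_ * X)|](rest _
  (fun j => (t j ^_ q j)%:R * z j ^+ (t j - q j))); last first.
  by move=> j /negbTE ->.
(* One more derivative in the variable [l] multiplies the falling factorial by [t l - q l]. *)
rewrite -/p mulr1n addn1 ffactnSr natrM subnS.
set n := (t l - q l)%N; set f := (t l ^_ q l)%:R.
have -> : a t * (f * (h + z l) ^+ n * p) - a t * (f * z l ^+ n * p)
    - h * (a t * (f * n%:R * z l ^+ n.-1 * p))
  = a t * f * p * ((z l + h) ^+ n - z l ^+ n - h * (n%:R * z l ^+ n.-1)).
  by rewrite [h + _]addrC; ring.
have -> : a t * (f * (`|z l| + d) ^+ n * p)
    = a t * f * p * (`|z l| + d) ^+ n by ring.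
rewrite !(normrM (a t * f * p)) [leRHS]mulrCA ler_wpM2l//.
rewrite normrX (@ger0_norm _ (`|z l| + d)) ?addr_ge0// ?(ltW d0)//.
exact: exprD_taylor_le.
Qed.

Lemma dseries_taylor_le a Rad q z (l : 'I_r) :
  ps_converges_on a Rad -> in_polydisk Rad z ->
  exists d M : Cx R, [/\ 0 < d, 0 <= M & forall h : Cx R, `|h| <= d ->
    in_polydisk Rad (fun j => h *+ (j == l) + z j) /\
    `|dseries a q (fun j => h *+ (j == l) + z j) - dseries a q z
       - h * dseries a (fun j => q j + (j == l))%N z| <= `|h| ^+ 2 * M].
Proof.
(* Half the distance to the boundary keeps the enlarged radius strictly inside the polydisk. *)
move=> acv zR; pose d : Cx R := ((Rad l)%:C%C - `|z l|) / 2.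
have d0 : 0 < d by rewrite divr_gt0// subr_gt0.
have zdR : `|z l| + d < (Rad l)%:C%C.
  by rewrite -ltrBrDl /d ltr_pdivrMr// mulr_natr mulr2n ltrDl subr_gt0.
clearbody d.
have sR : in_polydisk Rad (fun j => if j == l then `|z j| + d else z j).
  move=> j; case: eqVneq => [->|//].
  by rewrite ger0_norm// addr_ge0// ltW.
have [M sM] := dterm_bounded q acv sR.
exists d, (M / d ^+ 2); split=> // [|h hd].
  rewrite divr_ge0 ?exprn_ge0 ?(ltW d0)// (le_trans _ (sM 0%N))//.
  by apply: sumr_ge0 => t _.
have hR : in_polydisk Rad (fun j => h *+ (j == l) + z j).
  move=> j; case: eqVneq => [->|_]; last by rewrite mulr0n add0r.
  rewrite mulr1n addrC (le_lt_trans (ler_normD _ _))//.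
  by rewrite (le_lt_trans _ zdR)// lerD2l.
split=> //; pose q' j := (q j + (j == l))%N.
(* The estimate is proved on box sums, uniformly in [N], and passes to the limit. *)
have cvgS : (fun N => box_sum (dterm a q (fun j => h *+ (j == l) + z j)) N
     - box_sum (dterm a q z) N - h * box_sum (dterm a q' z) N) @ \oo
    --> dseries a q (fun j => h *+ (j == l) + z j) - dseries a q z
       - h * dseries a q' z.
  apply: cvgB; last by apply: cvgMl_tmp; exact: (dseries_cvg acv zR).
  by apply: cvgB; [exact: (dseries_cvg acv hR)|exact: (dseries_cvg acv zR)].
apply: (cvgn_norm_le cvgS) => N; rewrite /box_sum mulr_sumr -!sumrB.
apply: (le_trans (ler_norm_sum _ _ _)).
have -> : `|h| ^+ 2 * (M / d ^+ 2) = (`|h| / d) ^+ 2 * M.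
  by rewrite expr_div_n mulrA mulrAC.
apply: le_trans (ler_wpM2l _ (sM N)); last first.
  by rewrite exprn_ge0// divr_ge0// ltW.
rewrite /box_sum mulr_sumr; apply: ler_sum => t _.
exact: dterm_taylor_le.
Qed.

(** Agreement on the polydisk is enough to differentiate there, since small increments stay
    inside. *)
Definition eq_dseries a Rad (g : 'rV[Cx R]_r -> Cx R) q :=
  forall z : 'rV[Cx R]_r, in_polydisk Rad (z 0) -> g z = dseries a q (z 0).

(** Dividing the quadratic Taylor remainder by [h] leaves an error of order |h|. *)
Lemma partial_dseries a Rad g q (l : 'I_r) : ps_converges_on a Rad ->
  eq_dseries a Rad g q ->
  eq_dseries a Rad (partial l g) (fun j => q j + (j == l))%N.
Proof.
move=> acv gE z zR; have [d [M [d0 M0 taylor]]] := dseries_taylor_le q l acv zR.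
rewrite /partial /derive; apply/norm_cvg_lim; apply/cvgrPdist_lt => e e0.
(* [M] may be zero, so the threshold for [h] divides by [M + 1]. *)
have M1 : 0 < M + 1 by rewrite ltr_wpDl.
near=> h.
have h0 : h != 0 by near: h; exact: nbhs_dnbhs_neq.
have hd : `|h| <= d.
  by near: h; exact: dnbhs0_le.
have he : `|h| < e / (M + 1).
  by near: h; apply: dnbhs0_lt; exact: divr_gt0.
have [hR] := taylor h hd.
have zh : (h *: delta_mx 0 l + z) 0 = (fun j => h *+ (j == l) + z 0 j).
  by apply/funext => j; rewrite !mxE eqxx /= mulr_natr.
rewrite /= gE ?zh// gE//.
set F1 := dseries a q _; set F0 := dseries a q _; set F' := dseries a _ _.
move=> FM; rewrite -normrN opprB.
have -> : h^-1 *: (F1 - F0) - F' = h^-1 * (F1 - F0 - h * F').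
  by rewrite mulrBr mulKf.
rewrite normrM normfV mulrC ltr_pdivrMr ?normr_gt0//.
apply: (le_lt_trans FM); rewrite expr2 mulrAC ltr_pM2r ?normr_gt0//.
apply: (le_lt_trans (_ : _ <= `|h| * (M + 1))).
  by rewrite ler_wpM2l ?lerDl.
by rewrite -ltr_pdivlMr.
Unshelve. all: by end_near. Qed.

Lemma iter_partial_dseries a Rad g q (l : 'I_r) n : ps_converges_on a Rad ->
  eq_dseries a Rad g q ->
  eq_dseries a Rad (iter n (partial l) g) (fun j => q j + n * (j == l))%N.
Proof.
move=> acv gE; elim: n => [|n IH] /=.
  by move=> z zR; rewrite gE//; congr dseries; apply/funext => j; rewrite addn0.
move=> z zR; rewrite (partial_dseries l acv IH)//; congr dseries.
by apply/funext => j; rewrite mulSn addnCA addnC.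
Qed.

Lemma mpartial_dseries a Rad q z : ps_converges_on a Rad ->
  in_polydisk Rad z -> mpartial q (ps_fun a) (\row_l z l) = dseries a q z.
Proof.
move=> acv zR; have zrow : (\row_l z l) 0 = z by apply/funext => j; rewrite mxE.
(* The induction runs over arbitrary lists, counting occurrences of each variable; in [enum 'I_r]
   each occurs once. *)
suff foldE (s : seq 'I_r) : eq_dseries a Rad
    (foldr (fun l => iter (q l) (partial l)) (ps_fun a) s)
    (fun j => count_mem j s * q j)%N.
  rewrite /mpartial foldE zrow//; congr dseries; apply/funext => j.
  by rewrite count_uniq_mem ?enum_uniq// mem_enum mul1n.
elim: s => [|l s IH] /= w wR; first exact: ps_fun_dseries.
rewrite (iter_partial_dseries l (q l) acv IH)//; congr dseries.
apply/funext => j; rewrite mulnDl addnC eq_sym; congr addn.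
by case: eqVneq => [->|_]; rewrite ?muln1 ?mul1n ?muln0 ?mul0n.
Qed.

End DerivedSeries.

(** * The expansion of the matrix power series *)

Theorem mainTheorem11 (R : realType) (r m : nat) (hr : (1 <= r)%N)
  (a : {ffun 'I_r -> nat} -> Cx R) (Rad : 'I_r -> R)
  (hf : ps_converges_on a Rad)
  (X : 'I_r -> 'M[Cx R]_m) (D : 'I_r -> jordan_data R m)
  (hJ : forall l, is_jordan_decomposition (D l) (X l))
  (hlam : forall l (k : 'I_(jK (D l))), `|jlam (D l) k| < (Rad l)%:C%C) :
  mat_partial a X @ \oo -->
    \sum_(bs : {dffun forall l : 'I_r, jblock (D l)})
    \sum_(qs : {dffun forall l : 'I_r, 'I_(bsize (bs l))})
      ((mpartial (fun l => nat_of_ord (qs l)) (ps_fun a)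
          (\row_l jlam (D l) (tag (bs l)))
        / (\prod_(l < r) ((qs l)`!)%:R))
       *: \prod_(l < r) Qmat (bs l) (qs l)).
Proof.
have matE : mat_partial a X = (fun N =>
    \sum_(bs : {dffun forall l : 'I_r, jblock (D l)})
    \sum_(qs : {dffun forall l : 'I_r, 'I_(bsize (bs l))})
      ((box_sum (dterm a (fun l => nat_of_ord (qs l))
          (fun l => jlam (D l) (tag (bs l)))) N
        / (\prod_(l < r) ((qs l)`!)%:R))
       *: \prod_(l < r) Qmat (bs l) (qs l))).
  apply/funext => N; rewrite /mat_partial.
  transitivity (\sum_(t : {ffun 'I_r -> 'I_N})
    \sum_(bs : {dffun forall l : 'I_r, jblock (D l)})
    \sum_(qs : {dffun forall l : 'I_r, 'I_(bsize (bs l))})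
      ((dterm a (fun l => nat_of_ord (qs l))
          (fun l => jlam (D l) (tag (bs l))) (idx_of t)
        / (\prod_(l < r) ((qs l)`!)%:R))
       *: \prod_(l < r) Qmat (bs l) (qs l))).
    apply: eq_bigr => t _.
    (* Each power is expanded and the ordered product multiplied out, first over blocks, then over
       nilpotent exponents. *)
    under eq_bigr => l _ do rewrite (jordan_expn _ (hJ l)).
    rewrite prod_sum_dffun scaler_sumr; apply: eq_bigr => bs _.
    rewrite prod_sum_dffun scaler_sumr; apply: eq_bigr => qs _.
    rewrite prod_mx_scale scalerA; congr (_ *: _).
    rewrite /dterm -mulrA; congr (_ * _); rewrite -prodfV -big_split/=.
    (* The binomial coefficient is the falling factorial divided by q!. *)
    apply: eq_bigr => l _; rewrite -bin_ffact natrM [RHS]mulrAC.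
    by rewrite mulfK// pnatr_eq0 -lt0n fact_gt0.
  rewrite exchange_big; apply: eq_bigr => bs _.
  rewrite exchange_big; apply: eq_bigr => qs _.
  by rewrite /box_sum mulr_suml scaler_suml.
(* Both outer sums are finite and independent of [N], so the limit is taken coefficient by
   coefficient. *)
rewrite matE; apply: cvg_big => [|bs _]; first exact: add_continuous.
apply: cvg_big => [|qs _]; first exact: add_continuous.
have lamR : in_polydisk Rad (fun l => jlam (D l) (tag (bs l))).
  by move=> l; exact: hlam.
apply: cvgZr_tmp; apply: cvgMr_tmp; rewrite (mpartial_dseries _ hf lamR).
exact: dseries_cvg hf lamR.
Qed.
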